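(* Let $X$ be an effective Banach space that is not zero-dimensional, with countable dense set $A=\{a_n\}$ as in the context. Then no total numbering of $X_k$ gives modulus: there is no computable double sequence $(a_{ij})_{i,j\in\mathbb{N}}$ of elements of $A$ with $\|a_{i,j}-a_{i,j+1}\|<2^{-j}$ for all $i,j$ such that every element of $X_k$ equals $\lim_j a_{ij}$ for some $i$.
   Context: $X$ is an effective Banach space: a Banach space with a Pour-El–Richards computability structure (a set of ''computable sequences'' closed under computable linear combinations and effective limits, whose norms form computable real sequences) admitting a computable sequence $(e_n)$ with dense linear span. $X_k$ is its set of computable elements, and $(a_n)$ is a computable enumeration of the rational span $A$ of $(e_n)$. A total numbering of $X_k$ ''gives modulus'' if it has the form $i\mapsto\lim_j a_{ij}$ for a computable double sequence $(a_{ij})$ in $A$ with $\|a_{i,j}-a_{i,j+1}\|<2^{-j}$ for all $i,j$. *)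

(* Defs.v *)
From mathcomp Require Import all_boot all_order all_algebra.
From mathcomp Require Import complex.
From mathcomp Require Import all_classical all_reals all_analysis.

Set Implicit Arguments.
Unset Strict Implicit.
Unset Printing Implicit Defensive.

Import Order.TTheory GRing.Theory Num.Theory.
Import numFieldNormedType.Exports.

Local Open Scope classical_set_scope.
Local Open Scope ring_scope.

(* The total recursive functions, as the least class of total functions of all
   arities that contains the initial functions and is closed under composition,
   primitive recursion and regular minimization. The defined function h enters
   through its equations; in [rec_mu] regularity of f (every v has a zero) is
   implied by the existence of the total function h. *)
Inductive recursive : forall k : nat, (k.-tuple nat -> nat) -> Prop :=
| rec_zero k : recursive (fun _ : k.-tuple nat => 0%N)
| rec_succ : recursive (fun v : 1.-tuple nat => (tnth v ord0).+1)
| rec_proj k (i : 'I_k) : recursive (fun v : k.-tuple nat => tnth v i)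
| rec_comp k m (f : m.-tuple nat -> nat) (g : 'I_m -> k.-tuple nat -> nat)
    (h : k.-tuple nat -> nat) :
    recursive f -> (forall i, recursive (g i)) ->
    (forall v, h v = f [tuple g i v | i < m]) -> recursive h
| rec_prec k (f : k.-tuple nat -> nat) (g : k.+2.-tuple nat -> nat)
    (h : k.+1.-tuple nat -> nat) :
    recursive f -> recursive g ->
    (forall v, h (cons_tuple 0%N v) = f v) ->
    (forall n v, h (cons_tuple n.+1 v) =
       g (cons_tuple n (cons_tuple (h (cons_tuple n v)) v))) ->
    recursive h
| rec_mu k (f : k.+1.-tuple nat -> nat) (h : k.-tuple nat -> nat) :
    recursive f ->
    (forall v, f (cons_tuple (h v) v) = 0%N) ->
    (forall v y, (y < h v)%N -> f (cons_tuple y v) <> 0%N) ->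
    recursive h.

Definition recursive1 (f : nat -> nat) : Prop :=
  recursive (fun v : 1.-tuple nat => f (tnth v ord0)).

Definition recursive2 (f : nat -> nat -> nat) : Prop :=
  recursive (fun v : 2.-tuple nat => f (tnth v ord0) (tnth v ord_max)).

(* Cantor's bijection from nat * nat onto nat. *)
Definition cantor_pair (n k : nat) : nat := (((n + k) * (n + k).+1)./2 + k)%N.

(* [C] is a class of "computable sequences" in T; a double sequence is
   computable when its reindexing along the pairing function belongs to [C]. *)
Definition computable_double (T : Type) (C : set (nat -> T))
    (x : nat -> nat -> T) : Prop :=
  exists2 s : nat -> T, C s & forall n k, s (cantor_pair n k) = x n k.

Definition computable_rat_double (r : nat -> nat -> rat) : Prop :=
  exists s p q : nat -> nat -> nat,
    [/\ recursive2 s, recursive2 p, recursive2 q,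
        forall n k, q n k <> 0%N &
        forall n k, r n k = (-1) ^+ s n k * (p n k)%:R / (q n k)%:R].

Definition computable_real_seq (R : realType) (x : nat -> R) : Prop :=
  exists2 r : nat -> nat -> rat, computable_rat_double r &
    forall n k, `|ratr (r n k) - x n| <= 2 ^- k.

(* Banach spaces are real or complex. *)
Variant scalar_kind := RealScalars | ComplexScalars.

Definition scalars (R : realType) (s : scalar_kind) : numFieldType :=
  match s with RealScalars => R | ComplexScalars => R[i] end.

Definition re_part (R : realType) (s : scalar_kind) : scalars R s -> R :=
  match s return scalars R s -> R with
  | RealScalars => fun z => z
  | ComplexScalars => fun z => complex.Re z
  end.

Definition im_part (R : realType) (s : scalar_kind) : scalars R s -> R :=
  match s return scalars R s -> R with
  | RealScalars => fun _ => 0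
  | ComplexScalars => fun z => complex.Im z
  end.

Definition computable_scalar_seq (R : realType) (s : scalar_kind)
    (z : nat -> scalars R s) : Prop :=
  computable_real_seq (fun n => re_part (z n)) /\
  computable_real_seq (fun n => im_part (z n)).

(* Rational numbers in the real case, Gaussian rationals in the complex case. *)
Definition rational_scalar (R : realType) (s : scalar_kind)
    (z : scalars R s) : Prop :=
  exists p q : rat, re_part z = ratr p /\ im_part z = ratr q.

Section EffectiveBanachSpace.
Variables (R : realType) (s : scalar_kind).
Variable X : completeNormedModType (scalars R s).

(* The Pour-El--Richards axioms for the set S of computable sequences. The norm
   takes its values in the scalar field, so [re_part] only recasts it in R. *)
Record computability_structure (S : set (nat -> X)) : Prop := {
  linear_forms_axiom : forall (x y : nat -> X)
      (alpha beta : nat -> nat -> scalars R s) (d : nat -> nat),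
    S x -> S y ->
    computable_double (@computable_scalar_seq R s) alpha ->
    computable_double (@computable_scalar_seq R s) beta ->
    recursive1 d ->
    S (fun n => \sum_(k < (d n).+1) (alpha n k *: x k + beta n k *: y k));
  limits_axiom : forall (x : nat -> nat -> X) (y : nat -> X)
      (m : nat -> nat -> nat),
    computable_double S x -> recursive2 m ->
    (forall n N k, (m n N <= k)%N -> `|x n k - y n| <= 2 ^- N) ->
    S y;
  norms_axiom : forall x : nat -> X,
    S x -> computable_real_seq (fun n => re_part `|x n|)
}.

Definition linear_span (e : nat -> X) : set X :=
  [set x | exists n (c : nat -> scalars R s), x = \sum_(k < n) c k *: e k].

Definition rational_span (e : nat -> X) : set X :=
  [set x | exists n (c : nat -> scalars R s),
     (forall k, rational_scalar (c k)) /\ x = \sum_(k < n) c k *: e k].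

Definition effective_generating_set (S : set (nat -> X)) (e : nat -> X) : Prop :=
  S e /\ dense (linear_span e).

Definition computable_enumeration (S : set (nat -> X)) (A : set X)
    (a : nat -> X) : Prop :=
  S a /\ range a = A.

Definition computable_elements (S : set (nat -> X)) : set X :=
  [set x | S (fun _ => x)].

Definition total_numbering (T : set X) (nu : nat -> X) : Prop := range nu = T.

Definition modulus_double_seq (S : set (nat -> X)) (A : set X)
    (b : nat -> nat -> X) : Prop :=
  [/\ computable_double S b,
      forall i j, A (b i j) &
      forall i j, `|b i j - b i j.+1| < 2 ^- j].

Definition gives_modulus (S : set (nat -> X)) (A : set X)
    (nu : nat -> X) : Prop :=
  exists2 b : nat -> nat -> X, modulus_double_seq S A b &
    forall i, b i j @[j --> \oo] --> nu i.

End EffectiveBanachSpace.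

(* Main.v *)
(** Diagonalization along a line. Rescale some nonzero generator to a computable
    vector [u] with [1 <= |u| <= 2]. Build a real [t = sum_i d_i 8^-(i+1)] with
    digits [d_i] in [{0, 1}]: if [q] is the sum of the terms before stage [i] and
    [delta = 8^-(i+1)], compute [|b i j - q u|] to within a small fraction of
    [delta] for [j = 3 i + 8], and let [d_i = 1] iff the result is below
    [delta / 2]. If [d_i = 1] then [t u] is at distance at least [delta] from
    [q u], otherwise at most [2 delta / 7]; either way [t u] is not the limit of
    [b i]. The digits are recursive, so [t] and hence [t u] are computable. *)

Require Import Defs.
From mathcomp Require Import all_boot all_order all_algebra.
From mathcomp Require Import complex.
From mathcomp Require Import all_classical all_reals all_analysis.
From mathcomp Require Import zify lra.

Set Implicit Arguments.
Unset Strict Implicit.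
Unset Printing Implicit Defensive.

Import Order.TTheory GRing.Theory Num.Theory.
Import numFieldNormedType.Exports.

Local Open Scope classical_set_scope.
Local Open Scope ring_scope.

(** * Recursive functions of one and two arguments *)

Lemma recursive_comp1 (f : nat -> nat) (k : nat) (g : k.-tuple nat -> nat) :
  recursive1 f -> recursive g -> recursive (fun v => f (g v)).
Proof.
move=> rf rg; apply: (rec_comp (g := fun _ => g) rf) => // v.
by rewrite tnth_mktuple.
Qed.

Lemma recursive_comp2 (f : nat -> nat -> nat) (k : nat)
    (g h : k.-tuple nat -> nat) :
  recursive2 f -> recursive g -> recursive h ->
  recursive (fun v => f (g v) (h v)).
Proof.
move=> rf rg rh.
apply: (rec_comp (g := fun i : 'I_2 => if i == ord0 then g else h) rf).
  by move=> i; case: ifP.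
by move=> v; rewrite !tnth_mktuple.
Qed.

Lemma recursive_const (k c : nat) : recursive (fun _ : k.-tuple nat => c).
Proof.
elim: c => [|c IHc]; first exact: rec_zero.
exact: (recursive_comp1 rec_succ IHc).
Qed.

Lemma recursive1_comp (f g : nat -> nat) :
  recursive1 f -> recursive1 g -> recursive1 (fun n => f (g n)).
Proof. exact: recursive_comp1. Qed.

Lemma recursive1_comp2 (f : nat -> nat -> nat) (g h : nat -> nat) :
  recursive2 f -> recursive1 g -> recursive1 h ->
  recursive1 (fun n => f (g n) (h n)).
Proof. exact: recursive_comp2. Qed.

Lemma recursive2_comp1 (f : nat -> nat) (g : nat -> nat -> nat) :
  recursive1 f -> recursive2 g -> recursive2 (fun n m => f (g n m)).
Proof. exact: recursive_comp1. Qed.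

Lemma recursive2_comp (f g h : nat -> nat -> nat) :
  recursive2 f -> recursive2 g -> recursive2 h ->
  recursive2 (fun n m => f (g n m) (h n m)).
Proof. exact: recursive_comp2. Qed.

Lemma recursive1_id : recursive1 id. Proof. exact: rec_proj. Qed.
Lemma recursive1_const (c : nat) : recursive1 (fun=> c).
Proof. exact: recursive_const. Qed.
Lemma recursive2_const (c : nat) : recursive2 (fun _ _ => c).
Proof. exact: recursive_const. Qed.
Lemma recursive2_fst : recursive2 (fun n _ => n). Proof. exact: rec_proj. Qed.
Lemma recursive2_snd : recursive2 (fun _ m => m). Proof. exact: rec_proj. Qed.

Lemma recursive1_prec (c : nat) (g : nat -> nat -> nat) (h : nat -> nat) :
  recursive2 g -> h 0%N = c -> (forall n, h n.+1 = g n (h n)) -> recursive1 h.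
Proof.
move=> rg h0 hS.
apply: (rec_prec (recursive_const 0 c) rg) => // n v.
by rewrite !(tnth_nth 0%N) /= hS.
Qed.

Lemma recursive2_prec (f : nat -> nat) (g : nat -> nat -> nat -> nat)
    (h : nat -> nat -> nat) :
  recursive1 f ->
  recursive (fun v : 3.-tuple nat =>
    g (tnth v ord0) (tnth v (inord 1)) (tnth v ord_max)) ->
  (forall y, h 0%N y = f y) ->
  (forall n y, h n.+1 y = g n (h n y) y) -> recursive2 h.
Proof.
move=> rf rg h0 hS.
apply: (rec_prec rf rg) => [v|n v]; rewrite !(tnth_nth 0%N) /=.
  by rewrite h0.
by rewrite hS inordK.
Qed.

Lemma recursive1_mu (f : nat -> nat -> nat) (h : nat -> nat) :
  recursive2 f -> (forall n, f (h n) n = 0%N) ->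
  (forall n y, (y < h n)%N -> f y n <> 0%N) -> recursive1 h.
Proof.
move=> rf f0 fN0.
apply: (rec_mu rf) => [v|v y]; rewrite !(tnth_nth 0%N) /=.
  exact: f0.
exact: fN0.
Qed.

Lemma recursive2_add : recursive2 addn.
Proof.
apply: (@recursive2_prec id (fun _ m _ => m.+1)) => //.
  exact: recursive1_id.
exact: (recursive_comp1 rec_succ (rec_proj _)).
Qed.

Lemma recursive2_mul : recursive2 muln.
Proof.
apply: (@recursive2_prec (fun=> 0%N) (fun _ m y => (y + m)%N)) => //.
  exact: recursive1_const.
exact: (recursive_comp2 recursive2_add (rec_proj _) (rec_proj _)).
Qed.

Lemma recursive1_pred : recursive1 predn.
Proof. exact: (recursive1_prec (c := 0%N) recursive2_fst). Qed.

Lemma recursive2_sub : recursive2 subn.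
Proof.
(* Recursion runs on the first argument, so the subtrahend is put there: [m - n.+1] is the
   predecessor of [m - n]. *)
suff rsub : recursive2 (fun n m => (m - n)%N).
  exact: (recursive2_comp rsub recursive2_snd recursive2_fst).
apply: (@recursive2_prec id (fun _ m _ => m.-1)) => //.
- exact: recursive1_id.
- exact: (recursive_comp1 recursive1_pred (rec_proj _)).
- by move=> y; rewrite subn0.
- by move=> n y; rewrite subnS.
Qed.

Lemma recursive2_ltn : recursive2 (fun n m => (n < m)%N : nat).
Proof.
(* [n < m] means that the truncated difference [n.+1 - m] is 0. *)
have -> : (fun n m => (n < m)%N : nat) = (fun n m => 1 - (n.+1 - m))%N.
  by apply/funext => n; apply/funext => m; rewrite /leq; case: (n.+1 - m)%N.
apply: (recursive2_comp recursive2_sub (recursive2_const 1)).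
apply: (recursive2_comp recursive2_sub _ recursive2_snd).
exact: (recursive2_comp1 rec_succ recursive2_fst).
Qed.

Lemma recursive2_eqn : recursive2 (fun n m => (n == m) : nat).
Proof.
have -> : (fun n m => (n == m) : nat) =
    (fun n m => 1 - ((n < m)%N + (m < n)%N))%N.
  by apply/funext => n; apply/funext => m; case: ltngtP.
apply: (recursive2_comp recursive2_sub (recursive2_const 1)).
apply: (recursive2_comp recursive2_add recursive2_ltn).
exact: (recursive2_comp recursive2_ltn recursive2_snd recursive2_fst).
Qed.

Lemma recursive1_exp (c : nat) : recursive1 (expn c).
Proof.
apply: (@recursive1_prec 1 (fun _ m => c * m)%N) => [|//|n].
  exact: (recursive2_comp recursive2_mul (recursive2_const c) recursive2_snd).
by rewrite expnS.
Qed.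

(** * Cantor pairing and its recursive inverses *)

Definition triangular (n : nat) : nat := (n * n.+1)./2.

Lemma triangularS (n : nat) : triangular n.+1 = (triangular n + n.+1)%N.
Proof.
rewrite /triangular.
have -> : (n.+1 * n.+2 = (n.+1).*2 + n * n.+1)%N by lia.
by rewrite halfD odd_double add0n doubleK addnC.
Qed.

Lemma leq_triangular : {homo triangular : m n / (m <= n)%N}.
Proof.
apply: homo_leq => // [? ? ? le_ab|n]; first exact: leq_trans.
by rewrite triangularS leq_addr.
Qed.

Lemma recursive1_triangular : recursive1 triangular.
Proof.
apply: (recursive1_prec (c := 0%N) (g := fun n m => (m + n.+1)%N)) => //.
  apply: (recursive2_comp recursive2_add recursive2_snd).
  exact: (recursive2_comp1 rec_succ recursive2_fst).
exact: triangularS.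
Qed.

Lemma recursive2_cantor_pair : recursive2 cantor_pair.
Proof.
apply: (recursive2_comp recursive2_add _ recursive2_snd).
exact: (recursive2_comp1 recursive1_triangular recursive2_add).
Qed.

Lemma ltn_triangularS (m : nat) : exists w, (m < triangular w.+1)%N.
Proof. by exists m; rewrite triangularS addnS ltnS leq_addl. Qed.

(* The antidiagonal [n + k] of the pair coded by [m]. *)
Definition cantor_diag (m : nat) : nat := ex_minn (ltn_triangularS m).
Definition cantor_snd (m : nat) : nat := (m - triangular (cantor_diag m))%N.
Definition cantor_fst (m : nat) : nat := (cantor_diag m - cantor_snd m)%N.

(** The code [triangular (n + k) + k] lies in the block from [triangular (n + k)] up to, but
    excluding, [triangular (n + k).+1], since [k <= n + k]. *)
Lemma cantor_diagE (n k : nat) : cantor_diag (cantor_pair n k) = (n + k)%N.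
Proof.
rewrite /cantor_diag /cantor_pair -/(triangular _); case: ex_minnP => w wP wmin.
apply/eqP; rewrite eqn_leq wmin;
  last by rewrite triangularS ltn_add2l ltnS leq_addl.
rewrite leqNgt; apply/negP => lt_w; have := leq_triangular lt_w.
by move: wP; lia.
Qed.

Lemma cantor_sndE (n k : nat) : cantor_snd (cantor_pair n k) = k.
Proof. by rewrite /cantor_snd cantor_diagE addKn. Qed.

Lemma cantor_fstE (n k : nat) : cantor_fst (cantor_pair n k) = n.
Proof. by rewrite /cantor_fst cantor_sndE cantor_diagE addnK. Qed.

(** Regular minimization of a truncated difference that vanishes exactly when
    [m < triangular w.+1]. *)
Lemma recursive1_cantor_diag : recursive1 cantor_diag.
Proof.
apply: (recursive1_mu (f := fun w m => (m.+1 - triangular w.+1)%N)).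
- apply: (recursive2_comp recursive2_sub).
    exact: (recursive2_comp1 rec_succ recursive2_snd).
  apply: (recursive2_comp1 recursive1_triangular).
  exact: (recursive2_comp1 rec_succ recursive2_fst).
- by move=> n; apply/eqP; rewrite /cantor_diag; case: ex_minnP.
- move=> n y; rewrite /cantor_diag; case: ex_minnP => w _ wmin lt_yw /eqP.
  by move=> /wmin; rewrite leqNgt lt_yw.
Qed.

Lemma recursive1_cantor_snd : recursive1 cantor_snd.
Proof.
apply: (recursive1_comp2 recursive2_sub recursive1_id).
exact: (recursive1_comp recursive1_triangular recursive1_cantor_diag).
Qed.

Lemma recursive1_cantor_fst : recursive1 cantor_fst.
Proof.
exact: (recursive1_comp2 recursive2_sub recursive1_cantor_diag
          recursive1_cantor_snd).
Qed.

(** * Real and complex scalars; computable coefficients *)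

Section Scalars.
Context {R : realType} {s : scalar_kind}.

Definition of_real : R -> scalars R s :=
  match s return R -> scalars R s with
  | RealScalars => fun t => t
  | ComplexScalars => fun t => t%:C%C
  end.

Lemma re_part_of_real (t : R) : re_part (of_real t) = t.
Proof. by rewrite /of_real; case: s. Qed.

Lemma im_part_of_real (t : R) : im_part (of_real t) = 0.
Proof. by rewrite /of_real; case: s. Qed.

Lemma of_realB (t t' : R) : of_real (t - t') = of_real t - of_real t'.
Proof. by rewrite /of_real; case: s => //; exact: rmorphB. Qed.

Lemma of_real0 : of_real 0 = 0.
Proof. by rewrite /of_real; case: s. Qed.

Lemma of_real1 : of_real 1 = 1.
Proof. by rewrite /of_real; case: s. Qed.

(** The norm of a real scalar has zero imaginary part, so the real part is multiplicative here even
    over complex scalars. *)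
Lemma re_part_norm_of_realM (t : R) (z : scalars R s) :
  re_part (`|of_real t| * z) = `|t| * re_part z.
Proof.
rewrite /of_real; case: s z => //= -[x y].
by rewrite normc_def /= expr0n addr0 sqrtr_sqr mul0r subr0.
Qed.

Lemma re_partD (z z' : scalars R s) : re_part (z + z') = re_part z + re_part z'.
Proof. by case: s z z' => //= -[x y] [x' y']. Qed.

(** The order on complex numbers compares real parts and demands equal imaginary parts. *)
Lemma re_part_le (z z' : scalars R s) : z <= z' -> re_part z <= re_part z'.
Proof. by case: s z z' => //= -[x y] [x' y'] /andP[]. Qed.

Lemma re_part_lt (z z' : scalars R s) : z < z' -> re_part z < re_part z'.
Proof. by case: s z z' => //= -[x y] [x' y'] /andP[]. Qed.

Lemma re_part0 : re_part (0 : scalars R s) = 0.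
Proof. by case: s. Qed.

Lemma re_part_exp2V (n : nat) : re_part (2 ^- n : scalars R s) = 2 ^- n.
Proof.
case: s => //=.
have -> : (2 ^- n : R[i]) = (2 ^- n)%:C%C by rewrite fmorphV rmorphXn rmorph_nat.
by [].
Qed.

Lemma ratr_signed_quotient (F : numFieldType) (a p q : nat) :
  ratr ((-1) ^+ a * p%:R / q%:R) = (-1) ^+ a * p%:R / q%:R :> F.
Proof.
by rewrite rmorphM fmorphV rmorphM rmorphXn rmorphN1 !rmorph_nat.
Qed.

(** The approximations equal the values at every precision. *)
Lemma computable_real_seq_quotient (a p q : nat -> nat) (x : nat -> R) :
  recursive1 a -> recursive1 p -> recursive1 q -> (forall n, q n <> 0%N) ->
  (forall n, x n = (-1) ^+ a n * (p n)%:R / (q n)%:R) ->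
  computable_real_seq x.
Proof.
move=> ra rp rq q0 xE.
exists (fun n _ => (-1) ^+ a n * (p n)%:R / (q n)%:R).
  exists (fun n _ => a n), (fun n _ => p n), (fun n _ => q n).
  by split=> //; apply: (recursive2_comp1 _ recursive2_fst).
by move=> n k; rewrite ratr_signed_quotient xE subrr normr0 invr_ge0 exprn_ge0.
Qed.

Lemma computable_real_cst_nat (c : nat) : computable_real_seq (fun=> c%:R : R).
Proof.
apply: (computable_real_seq_quotient (recursive1_const 0) (recursive1_const c)
  (recursive1_const 1)) => // n.
by rewrite expr0 mul1r divr1.
Qed.

(** Coefficients supported at [k = d n] make a linear form pick out a single term of a sequence. *)
Lemma computable_double_select (x : nat -> R) (d : nat -> nat) :
  computable_real_seq x -> recursive1 d ->
  computable_double (@computable_scalar_seq R s)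
    (fun n k => of_real (if k == d n then x n else 0)).
Proof.
move=> [r [a [p [q [ra rp rq q0 rE]]]] rx] rd.
pose f := cantor_fst; pose c m : nat := cantor_snd m == d (f m).
exists (fun m => of_real (if cantor_snd m == d (f m) then x (f m) else 0));
  last by move=> n k; rewrite /f cantor_fstE cantor_sndE.
split; last first.
  under [X in computable_real_seq X]eq_fun do rewrite im_part_of_real.
  exact: (computable_real_cst_nat 0).
under [X in computable_real_seq X]eq_fun do rewrite re_part_of_real.
have rf g : recursive2 g -> recursive2 (fun m k => g (f m) k).
  move=> rg; apply: (recursive2_comp rg _ recursive2_snd).
  exact: (recursive2_comp1 recursive1_cantor_fst recursive2_fst).
have rc : recursive1 c.
  apply: (recursive1_comp2 recursive2_eqn recursive1_cantor_snd).
  exact: (recursive1_comp rd recursive1_cantor_fst).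
exists (fun m k => if cantor_snd m == d (f m) then r (f m) k else 0).
  (* The 0/1 indicator [c] multiplies the numerators only, which keeps every denominator nonzero. *)
  exists (fun m k => a (f m) k), (fun m k => c m * p (f m) k)%N,
    (fun m k => q (f m) k).
  split; try exact: rf.
  - apply: (recursive2_comp recursive2_mul _ (rf _ rp)).
    exact: (recursive2_comp1 rc recursive2_fst).
  - by move=> n k; apply: q0.
  - move=> n k; rewrite /c; case: ifP => _; first by rewrite mul1n rE.
    by rewrite mul0n mulr0 mul0r.
move=> m k; case: ifP => _; first exact: rx.
by rewrite rmorph0 subrr normr0 invr_ge0 exprn_ge0.
Qed.

End Scalars.

(** * Octal expansions with digits 0 and 1 *)

(** The intervals are nested, because [8 ^- i / 7] is the sum of all later terms when every later
    digit is 1. The supremum of the left ends therefore lies in all of them. *)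
Lemma binary_octal_expansion (R : realType) (D : nat -> bool) (N : nat -> nat) :
  N 0%N = 0%N -> (forall i, N i.+1 = (8 * N i + D i)%N) ->
  exists t : R, forall i,
    (N i)%:R / 8 ^+ i <= t <= (N i)%:R / 8 ^+ i + 8 ^- i / 7.
Proof.
move=> N0 NS; pose q i : R := (N i)%:R / 8 ^+ i; pose r i := q i + 8 ^- i / 7.
have e0 i : 0 < 8 ^- i :> R by rewrite invr_gt0 exprn_gt0.
have eS i : 8 ^- i.+1 = 8 ^- i / 8 :> R by rewrite exprS invfM mulrC.
have qS i : q i.+1 = q i + (D i)%:R * (8 ^- i / 8).
  by rewrite /q NS eS natrD natrM; lra.
have D01 i : 0 <= ((D i)%:R : R) <= 1 by case: (D i); rewrite ?lexx ?ler01.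
have q_nd : {homo q : i j / (i <= j)%N >-> i <= j}.
  apply: homo_leq => // [j i k|i]; first exact: le_trans.
  by rewrite qS; have := D01 i; have := e0 i; nra.
have r_ni : {homo r : i j / (i <= j)%N >-> j <= i}.
  apply: homo_leq => // [j i k ij jk|i]; first exact: le_trans jk ij.
  by rewrite /r qS eS; have := D01 i; have := e0 i; nra.
(* Ends from different stages are compared at the later stage. *)
have qr i j : q i <= r j.
  apply: (@le_trans _ _ (q (maxn i j))); first exact/q_nd/leq_maxl.
  apply: (@le_trans _ _ (r (maxn i j))); last exact/r_ni/leq_maxr.
  by rewrite /r lerDl; have := e0 (maxn i j); lra.
exists (sup (range q)) => i; apply/andP; split.
  apply: ub_le_sup; last by exists i.
  by exists (r 0%N) => _ [j _ <-].
by apply: ge_sup => [|_ [j _ <-]]; [exists (q 0%N), 0%N|exact: qr].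
Qed.

(** * Real-valued norms and rates of convergence *)

Section NormedSpace.
Context {R : realType} {s : scalar_kind}.
Variable X : completeNormedModType (scalars R s).
Implicit Types (x y : X) (S : set (nat -> X)).

Definition real_norm x : R := re_part `|x|.

Lemma real_norm_ge0 x : 0 <= real_norm x.
Proof. by rewrite -(@re_part0 R s); exact/re_part_le/normr_ge0. Qed.

Lemma real_norm_gt0 x : x != 0 -> 0 < real_norm x.
Proof. by rewrite -normr_gt0 => /re_part_lt; rewrite re_part0. Qed.

Lemma ler_real_normD x y : real_norm (x + y) <= real_norm x + real_norm y.
Proof. by rewrite -re_partD; exact/re_part_le/ler_normD. Qed.

Lemma real_distC x y : real_norm (x - y) = real_norm (y - x).
Proof. by rewrite /real_norm distrC. Qed.

Lemma ler_real_distD y x z :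
  real_norm (x - z) <= real_norm (x - y) + real_norm (y - z).
Proof. by apply: le_trans (ler_real_normD _ _); rewrite addrA subrK. Qed.

Lemma real_normZ (t : R) x : real_norm (of_real t *: x) = `|t| * real_norm x.
Proof. by rewrite /real_norm normrZ re_part_norm_of_realM. Qed.

(** Telescoping costs at most [2 * 2 ^- j], and some later term is within [2 ^- j] of the limit;
    hence the factor 3. *)
Lemma fast_cauchy_dist (b : nat -> X) y :
  (forall j, `|b j - b j.+1| < 2 ^- j) -> b j @[j --> \oo] --> y ->
  forall j, real_norm (b j - y) <= 3 * 2 ^- j.
Proof.
move=> bS by_ j.
have bSR i : real_norm (b i - b i.+1) < 2 ^- i.
  by rewrite -(@re_part_exp2V R s); exact/re_part_lt/bS.
(* The subtracted term makes the induction close: it halves at each step, which frees exactly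
   [2 ^- (j + k)]. *)
have bb k : real_norm (b j - b (j + k)%N) <= 2 * 2 ^- j - 2 * 2 ^- (j + k).
  elim: k => [|k IHk].
    by rewrite addn0 !subrr /real_norm normr0 re_part0.
  have := ler_real_distD (b (j + k)%N) (b j) (b (j + k.+1)%N).
  have := bSR (j + k)%N; rewrite addnS exprS invfM.
  by move: IHk; lra.
have e0 : 0 < 2 ^- j :> scalars R s by rewrite invr_gt0 exprn_gt0.
have /cvgrPdist_lt/(_ _ e0)[M _ MP] := by_.
have /MP/re_part_lt : (M <= j + M)%N by rewrite leq_addl.
rewrite re_part_exp2V -/(real_norm _) (real_distC y).
have := ler_real_distD (b (j + M)%N) (b j) y; have := bb M.
have : 0 < 2 ^- (j + M) :> R by rewrite invr_gt0 exprn_gt0.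
by lra.
Qed.

(** * Computable vectors *)

(** With both coefficient arrays supported at [d n], the linear form keeps only its last summand.
    The identity and the constant [d] give the next two closure properties. *)
Lemma computable_combination S (x y : nat -> X) (A B : nat -> R)
    (d : nat -> nat) :
  computability_structure S -> S x -> S y ->
  computable_real_seq A -> computable_real_seq B -> recursive1 d ->
  S (fun n => of_real (A n) *: x (d n) + of_real (B n) *: y (d n)).
Proof.
move=> hS Sx Sy cA cB rd.
have := linear_forms_axiom hS Sx Sy (computable_double_select cA rd)
  (computable_double_select cB rd) rd.
congr S; apply/funext => n; rewrite big_ord_recr /= eqxx big1 ?add0r// => k _.
by rewrite ltn_eqF// of_real0 !scale0r addr0.
Qed.

Lemma computable_scale S x (t : R) :
  computability_structure S -> computable_elements S x ->
  computable_real_seq (fun=> t) -> computable_elements S (of_real t *: x).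
Proof.
move=> hS Sx ct.
have := computable_combination hS Sx Sx ct (computable_real_cst_nat 0)
  recursive1_id.
by congr S; apply/funext => n; rewrite of_real0 scale0r addr0.
Qed.

Lemma computable_term S (x : nat -> X) (k : nat) :
  computability_structure S -> S x -> computable_elements S (x k).
Proof.
move=> hS Sx.
have := computable_combination hS Sx Sx (computable_real_cst_nat 1)
  (computable_real_cst_nat 0) (recursive1_const k).
by congr S; apply/funext => n; rewrite of_real0 of_real1 scale0r scale1r addr0.
Qed.

(** If all generators vanished, the span would be zero and miss the ball about [x] whose radius is
    the norm of [x]. *)
Lemma dense_span_neq0 (e : nat -> X) :
  dense (linear_span e) -> (exists x, x != 0) -> exists k, e k != 0.
Proof.
move=> de [x x0]; apply: contrapT => /forallNP e0.
have {}e0 k : e k = 0 by apply/eqP; rewrite -[_ == _]negbK; exact/negP/e0.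
have := de (ball x `|x|) _ (ball_open _ _).
case; first by exists x; apply: ballxx; rewrite normr_gt0.
move=> y [xy [n [c yE]]]; move: xy.
rewrite yE big1 => [|k _]; last by rewrite e0 scaler0.
by rewrite -ball_normE /ball_ /= subr0 ltxx.
Qed.

Lemma computable_unit_vector S (e : nat -> X) :
  computability_structure S -> effective_generating_set S e ->
  (exists x, x != 0) ->
  exists2 u, computable_elements S u & 1 <= real_norm u <= 2.
Proof.
move=> hS [Se de] /(dense_span_neq0 de)[k ek0].
have c0 := real_norm_gt0 ek0; set c := real_norm _ in c0.
(* A rational factor between [c^-1] and [2 / c] puts the norm in range and is itself a computable
   constant. *)
have c_lt : c^-1 < 2 / c by rewrite ltr_pdivlMr// mulVf ?gt_eqF// ltr1n.
have [r] := rat_in_itvoo c_lt; rewrite in_itv /= => /andP[r_gt r_lt].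
have r0 : 0 < ratr r :> R by apply: lt_trans r_gt; rewrite invr_gt0.
exists (of_real (ratr r) *: e k); last first.
  rewrite real_normZ -/c gtr0_norm//; apply/andP; split.
    by rewrite -ler_pdivrMr// mul1r ltW.
  by rewrite -ler_pdivlMr// ltW.
apply: computable_scale => //; first exact: computable_term.
apply: (computable_real_seq_quotient (recursive1_const 0)
  (recursive1_const `|numq r|) (recursive1_const `|denq r|)).
  by move=> _; apply/eqP; rewrite absz_eq0 denq_neq0.
move=> _; rewrite expr0 mul1r.
(* A positive rational has a nonnegative numerator, so sign exponent 0 and absolute values represent
   it. *)
have nr0 : 0 <= numq r by rewrite numq_ge0 -(ler0q R) ltW.
by rewrite !natr_absz !ger0_norm ?denq_ge0.
Qed.

(** * The diagonal argument *)

Lemma computable_diagonal S u (b : nat -> nat -> X) :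
  computability_structure S -> computable_elements S u ->
  1 <= real_norm u <= 2 -> computable_double S b ->
  (forall i j, `|b i j - b i j.+1| < 2 ^- j) ->
  exists2 x, computable_elements S x & forall i, ~ b i j @[j --> \oo] --> x.
Proof.
move=> hS Su u12 [sb Ssb sbE] bS.
(* [2 ^- J i = 8 ^- i.+1 / 32]: the error of [b i (J i)], at most [3 * 2 ^- J i],
   and that of its approximate norm stay well below the gap left at stage [i]. *)
pose J i := (3 * i + 8)%N.
have rJ : recursive1 J.
  apply: (recursive1_comp2 recursive2_add _ (recursive1_const 8)).
  exact: (recursive1_comp2 recursive2_mul (recursive1_const 3) recursive1_id).
(* Position in [sb] of [b i (J i)], where [n] codes the stage [i] and a candidate numerator. All
   candidates are treated at once, since the norms axiom takes one sequence, fixed before the digits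
   are known. *)
pose d n := cantor_pair (cantor_fst n) (J (cantor_fst n)).
have rd : recursive1 d.
  apply: (recursive1_comp2 recursive2_cantor_pair recursive1_cantor_fst).
  exact: (recursive1_comp rJ recursive1_cantor_fst).
(* Minus the candidate partial sum; the norms below are those of [b i (J i)] minus this multiple of
   [u]. *)
pose B n : R := (-1) ^+ 1 * (cantor_snd n)%:R / (8 ^ cantor_fst n)%:R.
have cB : computable_real_seq B.
  apply: (computable_real_seq_quotient (recursive1_const 1)
    recursive1_cantor_snd
    (recursive1_comp (recursive1_exp 8) recursive1_cantor_fst)) => // n.
  by apply/eqP; rewrite expn_eq0.
have := norms_axiom hS (computable_combination hS Ssb Su
  (computable_real_cst_nat 1) cB rd).
move=> [r [a [p [q [ra rp rq q0 rE]]]] rz].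
(* The sign of the approximation is dropped: a norm is nonnegative, so this can
   only improve it. *)
pose D i N := (p (cantor_pair i N) (J i) * (2 * 8 ^ i.+1)
  < q (cantor_pair i N) (J i))%N.
(* Numerator over [8 ^ i] of the partial sum. Each digit depends only on [i] and the current
   numerator, so this is a primitive recursion. *)
pose N i := iteri i (fun i N => 8 * N + D i N)%N 0%N.
have rN : recursive1 N.
  apply: (recursive1_prec (c := 0%N) (g := fun i N => 8 * N + D i N)%N) => //.
  apply: (recursive2_comp recursive2_add).
    exact: (recursive2_comp recursive2_mul (recursive2_const 8) recursive2_snd).
  have rJ2 f :
      recursive2 f -> recursive2 (fun i N => f (cantor_pair i N) (J i)).
    move=> rf; apply: (recursive2_comp rf recursive2_cantor_pair).
    exact: (recursive2_comp1 rJ recursive2_fst).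
  apply: (recursive2_comp recursive2_ltn _ (rJ2 _ rq)).
  apply: (recursive2_comp recursive2_mul (rJ2 _ rp)).
  apply: (recursive2_comp recursive2_mul (recursive2_const 2)).
  apply: (recursive2_comp1 (recursive1_exp 8)).
  exact: (recursive2_comp1 rec_succ recursive2_fst).
have [//|//|t tP] := @binary_octal_expansion R (fun i => D i (N i)) N.
exists (of_real t *: u).
  apply: computable_scale => //.
  (* The partial sums approximate [t] within [8 ^- k / 7], which is below [2 ^- k]. *)
  exists (fun _ k => (-1) ^+ 0 * (N k)%:R / (8 ^ k)%:R).
    exists (fun _ _ => 0%N), (fun _ k => N k), (fun _ k => 8 ^ k)%N.
    split=> //; first exact: recursive2_const.
    - exact: (recursive2_comp1 rN recursive2_snd).
    - exact: (recursive2_comp1 (recursive1_exp 8) recursive2_snd).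
    - by move=> _ k; apply/eqP; rewrite expn_eq0.
  move=> _ k; rewrite ratr_signed_quotient expr0 mul1r natrX.
  have := tP k.
  have : 8 ^- k <= 2 ^- k :> R.
    by rewrite lef_pV2 ?posrE ?exprn_gt0// lerXn2r// ?nnegrE// ler_nat.
  have : 0 < 8 ^- k :> R by rewrite invr_gt0 exprn_gt0.
  by rewrite ler_norml; lra.
move=> i /(fast_cauchy_dist (bS i)) /(_ (J i)).
set n := cantor_pair i (N i).
have := rz n (J i).
rewrite rE ratr_signed_quotient /d /B /n cantor_fstE cantor_sndE sbE -/n.
set w := b i (J i); pose v := of_real ((N i)%:R / 8 ^+ i) *: u.
have -> : of_real 1 *: w +
    of_real ((-1) ^+ 1 * (N i)%:R / (8 ^ i)%:R) *: u = w - v.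
  rewrite of_real1 scale1r /v -scaleNr -[- of_real _]add0r -of_real0 -of_realB.
  by rewrite expr1 mulN1r mulNr natrX sub0r.
have -> : 2 ^- J i = 8 ^- i.+1 / 32 :> R.
  have -> : 8 = 2 ^+ 3 :> R by rewrite -natrX.
  have -> : 32 = 2 ^+ 5 :> R by rewrite -natrX.
  rewrite -invfM -exprM -exprD; congr (_ ^- _).
  by rewrite /J; lia.
set y := of_real t *: u; set m := real_norm (w - v).
set c := (p n (J i))%:R / (q n (J i))%:R : R; rewrite -/(real_norm _) -/m.
have c_ge0 : 0 <= c by rewrite divr_ge0.
move=> c_m w_y.
have {}c_m : `|c - m| <= 8 ^- i.+1 / 32.
  apply: le_trans c_m; rewrite -mulrA -/c.
  have m_ge0 : 0 <= m := real_norm_ge0 _.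
  (* With an odd sign the measured error is [c + m], which dominates the distance from [c] to
     [m]. *)
  rewrite -signr_odd; case: odd; rewrite ?expr0 ?expr1 ?mul1r// mulN1r.
  by rewrite -opprD normrN (ger0_norm (addr_ge0 c_ge0 m_ge0)) ler_norml; lra.
have vy : real_norm (y - v) = (t - (N i)%:R / 8 ^+ i) * real_norm u.
  rewrite -scalerBl -of_realB real_normZ ger0_norm// subr_ge0.
  by have /andP[] := tP i.
(* This triangle inequality will refute digit 1, the next one digit 0. *)
have := ler_real_distD w y v; rewrite (real_distC y w) -/m.
have := ler_real_distD y w v; rewrite -/m.
have e0 : 0 < 8 ^- i.+1 :> R by rewrite invr_gt0 exprn_gt0.
have qn0 : 0 < (q n (J i))%:R :> R by rewrite ltr0n lt0n; exact/eqP/q0.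
(* The integer test in [D] is this comparison cleared of denominators. *)
have cD : if D i (N i) then c < 8 ^- i.+1 / 2 else 8 ^- i.+1 / 2 <= c.
  have -> : 8 ^- i.+1 / 2 = ((2 * 8 ^ i.+1)%:R)^-1 :> R.
    by rewrite natrM natrX invfM mulrC.
  have h0 : 0 < (2 * 8 ^ i.+1)%:R :> R by rewrite ltr0n muln_gt0 expn_gt0.
  rewrite /D -/n; case: ltnP => pq.
    by rewrite /c ltr_pdivrMr// mulrC ltr_pdivlMr// -natrM ltr_nat.
  by rewrite /c ler_pdivlMr// mulrC ler_pdivrMr// -natrM ler_nat.
(* The enclosure of [t] at stage [i.+1] exposes the digit chosen at stage [i]. *)
have qS : (N i.+1)%:R / 8 ^+ i.+1 =
    (N i)%:R / 8 ^+ i + (D i (N i))%:R * 8 ^- i.+1 :> R.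
  by rewrite /N iteriS -/(N i) natrD natrM exprS invfM; lra.
have := tP i.+1; rewrite qS vy.
move: u12 c_m w_y e0 cD; rewrite ler_norml.
set h := t - _; set l := real_norm u; set e := 8 ^- i.+1.
move=> /andP[l1 l2] /andP[c_m m_c] w_y e0 cD /andP[t_ge t_le] hl1 hl2.
case: (D i (N i)) cD t_ge t_le => /= cD;
  rewrite ?mul1r ?mul0r => t_ge t_le.
  (* Digit 1: [h * l >= e], but the measured norm gives [h * l < e / 2 + e / 32 + 3 * e / 32]. *)
  have e_h : e <= h by rewrite /h; lra.
  have : e * 1 <= h * l by apply: ler_pM => //; exact: ltW.
  by lra.
(* Digit 0: [m >= e / 2 - e / 32], but [m <= 3 * e / 32 + 2 * e / 7]. *)
have h_e : 0 <= h <= e / 7 by rewrite /h; lra.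
have : h * l <= (e / 7) * 2 by apply: ler_pM => //; lra.
by lra.
Qed.

End NormedSpace.

Theorem theorem32 (R : realType) (s : scalar_kind)
    (X : completeNormedModType (scalars R s))
    (S : set (nat -> X)) (e a : nat -> X)
    (hS : computability_structure S)
    (he : effective_generating_set S e)
    (ha : computable_enumeration S (rational_span e) a)
    (hX : exists x : X, x != 0) :
  (forall nu : nat -> X, total_numbering (computable_elements S) nu ->
     ~ gives_modulus S (range a) nu) /\
  ~ (exists2 b : nat -> nat -> X, modulus_double_seq S (range a) b &
       forall x : X, computable_elements S x ->
         exists i : nat, b i j @[j --> \oo] --> x).
Proof.
have [u Su u12] := computable_unit_vector hS he hX.
(* Under a numbering every computable element is some [nu i], the limit of row [i], so the first
   claim follows from the second. *)
suff no_b : ~ (exists2 b : nat -> nat -> X, modulus_double_seq S (range a) b &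
    forall x : X, computable_elements S x ->
      exists i : nat, b i j @[j --> \oo] --> x).
  split=> // nu nuE [b bP bnu]; apply: no_b; exists b => // x.
  by rewrite -nuE => -[i _ <-]; exists i.
move=> [b [cb _ bS] bP].
have [x /bP[i bix] bNx] := computable_diagonal hS Su u12 cb bS.
exact: bNx bix.
Qed.
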